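(* Let $A$ be a Banach algebra, $\varphi\in\Delta(A)$ and $d\in A^*$. Then the following assertions are equivalent. (a) $d$ is a continuous point derivation at $\varphi$ of $A$. (b) $d$ is a continuous derivation from $A$ into $\mathbb{C}_\varphi$. (c) $\mathfrak{D}_{d,\varphi}$ is a continuous derivation. In this case, $d|_{M_\varphi^2}=0$.
   Context: Let $A$ be a complex Banach algebra with dual $A^*$. For $F\in A^*$ and $a,b\in A$ put $\langle F\cdot a,b\rangle=\langle F,ab\rangle$ and $\langle a\cdot F,b\rangle=\langle F,ba\rangle$. A linear operator $D$ from $A$ into a Banach $A$-bimodule (such as $A^*$) is a derivation if $D(ab)=D(a)\cdot b+a\cdot D(b)$ for all $a,b\in A$. $\Delta(A)$ is the set of all non-zero multiplicative linear functionals on $A$; for $\varphi\in\Delta(A)$, $M_\varphi=\ker\varphi$, and $M_\varphi^2$ is the linear span of products $xy$ with $x,y\in M_\varphi$. $\mathbb{C}_\varphi$ denotes $\mathbb{C}$ with the Banach $A$-bimodule structure $a\cdot\alpha=\alpha\cdot a=\varphi(a)\alpha$ ($a\in A$, $\alpha\in\mathbb{C}$). A functional $d\in A^*$ is a continuous point derivation of $A$ at $\varphi$ if $d(ab)=d(a)\varphi(b)+\varphi(a)d(b)$ for all $a,b\in A$. For $F_1,F_2\in A^*$, $\mathfrak{D}_{F_1,F_2}:A\to A^*$ is the continuous linear operator $\langle\mathfrak{D}_{F_1,F_2}(a),b\rangle=F_1(a)F_2(b)$. *)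

(* Defs.v *)
From HB Require Import structures.
From mathcomp Require Import all_boot all_order all_algebra.
From mathcomp Require Import complex.
From mathcomp Require Import boolp classical_sets functions reals.
From mathcomp Require Import interval_inference.
From mathcomp Require Import topology normedtype sequences.

Set Implicit Arguments.
Unset Strict Implicit.
Unset Printing Implicit Defensive.

Import Order.TTheory GRing.Theory Num.Theory.
Import numFieldNormedType.Exports.

Local Open Scope classical_set_scope.
Local Open Scope ring_scope.
Local Open Scope complex_scope.

Reserved Notation "x ** y" (at level 40, left associativity).

(* Banach algebras need not be unital, so the product is not that of a
   mathcomp ring. *)
HB.mixin Record CompleteNormedModule_isBanachAlgebra (K : numFieldType) A
    & CompleteNormedModule K A := {
  bmul : A -> A -> A;
  bmulA : associative bmul;
  bmulDl : left_distributive bmul +%R;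
  bmulDr : right_distributive bmul +%R;
  bscalerAl : forall (k : K) (a b : A), k *: bmul a b = bmul (k *: a) b;
  bscalerAr : forall (k : K) (a b : A), k *: bmul a b = bmul a (k *: b);
  ler_normbM : forall a b : A, `|bmul a b| <= `|a| * `|b|
}.

#[short(type="banachAlgType")]
HB.structure Definition BanachAlgebra (K : numFieldType) :=
  {A of CompleteNormedModule K A & CompleteNormedModule_isBanachAlgebra K A}.

Notation "a ** b" := (bmul a b) : ring_scope.

HB.mixin Record CompleteNormedModule_isBanachBimodule (K : numFieldType)
    (A : banachAlgType K) X & CompleteNormedModule K X := {
  lact : A -> X -> X;
  ract : X -> A -> X;
  lactDl : forall a b x, lact (a + b) x = lact a x + lact b x;
  lactDr : forall a x y, lact a (x + y) = lact a x + lact a y;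
  lactZl : forall (k : K) a x, lact (k *: a) x = k *: lact a x;
  lactZr : forall (k : K) a x, lact a (k *: x) = k *: lact a x;
  ractDl : forall x y a, ract (x + y) a = ract x a + ract y a;
  ractDr : forall x a b, ract x (a + b) = ract x a + ract x b;
  ractZl : forall (k : K) x a, ract (k *: x) a = k *: ract x a;
  ractZr : forall (k : K) x a, ract x (k *: a) = k *: ract x a;
  lactM : forall a b x, lact (a ** b) x = lact a (lact b x);
  ractM : forall x a b, ract x (a ** b) = ract (ract x a) b;
  lractA : forall a x b, ract (lact a x) b = lact a (ract x b);
  lact_bounded : exists M : K, forall a x, `|lact a x| <= M * `|a| * `|x|;
  ract_bounded : exists M : K, forall x a, `|ract x a| <= M * `|x| * `|a|
}.

#[short(type="banachBimodType")]
HB.structure Definition BanachBimodule (K : numFieldType)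
    (A : banachAlgType K) :=
  {X of CompleteNormedModule K X & CompleteNormedModule_isBanachBimodule K A X}.

Definition is_derivation (K : numFieldType) (A : banachAlgType K)
    (X : banachBimodType A) (D : A -> X) :=
  linear D /\ forall a b, D (a ** b) = ract (D a) b + lact a (D b).

Definition lin_span (K : numFieldType) (V : lmodType K) (S : set V) : set V :=
  [set v | exists n (c : 'I_n -> K) (s : 'I_n -> V),
    (forall i, S (s i)) /\ v = \sum_(i < n) c i *: s i].

Section complex_complete.
Variable R : realType.

Lemma normr_ReE (V : normedZmodType R[i]) (x : V) :
  `|x| = (complex.Re `|x|)%:C.
Proof. by rewrite RRe_real// normr_real. Qed.

Lemma normr_Re_ge0 (V : normedZmodType R[i]) (x : V) : 0 <= complex.Re `|x|.
Proof. by rewrite -ler0c -normr_ReE. Qed.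

Lemma gt0_complexE (e : R[i]) : 0 < e -> exists2 r : R, 0 < r & e = r%:C.
Proof.
move=> e0; have eE : e = (complex.Re e)%:C by rewrite RRe_real// gtr0_real.
by exists (complex.Re e) => //; rewrite -ltcR -eE.
Qed.

Lemma normc_ge_Im (z : R[i]) : `|complex.Im z|%:C <= `|z|.
Proof.
case: z => a b; rewrite normc_def lecR /= -sqrtr_sqr ler_wsqrtr//.
by rewrite lerDr sqr_ge0.
Qed.

Lemma complex_cauchy_cvg (F : set_system R[i]^o) :
  ProperFilter F -> cauchy F -> cvg F.
Proof.
move=> FF /cauchyP Fc.
have proj (p : R[i] -> R) : (forall z w, `|p z - p w|%:C <= `|z - w|) ->
    cvg (p @ (F : set_system R[i])).
  move=> pB; apply: cauchy_cvg; apply: cauchy_exP => _/posnumP[e].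
  have [|z Fz] := Fc e%:num%:C; first by rewrite ltcR.
  exists (p z); apply: (@filterS _ F _ (ball z e%:num%:C)) Fz => w /= zw.
  by rewrite /ball/= -ltcR; exact: le_lt_trans (pB z w) zw.
have /cvg_ex[a Fa] : cvg ((@complex.Re R) @ (F : set_system R[i])).
  by apply: proj => z w; rewrite -raddfB; exact: normc_ge_Re.
have /cvg_ex[b Fb] : cvg ((@complex.Im R) @ (F : set_system R[i])).
  by apply: proj => z w; rewrite -raddfB; exact: normc_ge_Im.
apply/cvg_ex; exists (a +i* b); apply/cvgrPdist_lt => e /gt0_complexE[r r0 ->].
have r20 : 0 < r / 2 by rewrite divr_gt0.
have Na : \forall t \near F, `|a - complex.Re t| < r / 2.
  by move/cvgrPdist_lt : Fa; exact.
have Nb : \forall t \near F, `|b - complex.Im t| < r / 2.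
  by move/cvgrPdist_lt : Fb; exact.
near=> t.
have ta : `|a - complex.Re t| < r / 2 by near: t.
have tb : `|b - complex.Im t| < r / 2 by near: t.
rewrite [_ - t](_ : _ =
  (a - complex.Re t)%:C + 'i%C * (b - complex.Im t)%:C); last first.
  by case: (t) => c d; rewrite [LHS]complexE.
apply: le_lt_trans (ler_normD _ _) _; rewrite normrM.
rewrite !normc_def/= !expr0n/= !expr1n !addr0 !add0r sqrtr1 !sqrtr_sqr mul1r.
by rewrite -rmorphD/= ltcR [ltRHS]splitr ltrD.
Unshelve. all: by end_near. Qed.

End complex_complete.

Section dual.
Variables (R : realType) (V : normedModType R[i]).

Definition dual_pred : {pred V -> R[i]^o} :=
  mem [set f : V -> R[i]^o | linear f /\ continuous f].

Record dual := Dual {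
  dual_fun : V -> R[i]^o;
  dual_funP : dual_fun \in dual_pred
}.

HB.instance Definition _ := [isSub for dual_fun].
HB.instance Definition _ := [Choice of dual by <:].

Fact dual_submod_closed : submod_closed dual_pred.
Proof.
split=> [|a f g /set_mem[lf cf] /set_mem[lg cg]]; apply: mem_set; split.
- by move=> a u v; rewrite /= scaler0 addr0.
- by move=> x; exact: cvg_cst.
- move=> b u v.
  rewrite -[LHS]/(a *: f (b *: u + v) + g (b *: u + v)) lf lg.
  rewrite -[RHS]/(b *: (a *: f u + g u) + (a *: f v + g v)).
  by rewrite !scalerDr !scalerA mulrC addrACA.
- by move=> x; apply: cvgD; [apply: cvgZr; exact: cf|exact: cg].
Qed.

HB.instance Definition _ := GRing.isSubmodClosed.Build _ _ dual_pred
  dual_submod_closed.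
HB.instance Definition _ := [SubChoice_isSubLmodule of dual by <:].

End dual.

Coercion dual_fun : dual >-> Funclass.

Section dual_norm.
Variables (R : realType) (V : normedModType R[i]).
Implicit Types F G : dual V.

Lemma dual_linear F : linear F.
Proof. by have := dual_funP F; rewrite inE => -[]. Qed.

HB.instance Definition _ F :=
  GRing.isLinear.Build R[i] V R[i]^o *:%R F (@dual_linear F).

Lemma dual_continuous F : continuous F.
Proof. by have := dual_funP F; rewrite inE => -[]. Qed.

Lemma dualP F G : F =1 G -> F = G.
Proof. by move=> FG; apply/val_inj/funext. Qed.

Lemma dualDE F G x : (F + G) x = F x + G x. Proof. by []. Qed.

Lemma dualNE F x : (- F) x = - F x. Proof. by []. Qed.

Lemma dualZE (k : R[i]) F x : (k *: F) x = k * F x. Proof. by []. Qed.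

Lemma bounded_continuous (W : normedModType R[i]) (f : {linear V -> W})
  (M : R[i]) : (forall x, `|f x| <= M * `|x|) -> continuous f.
Proof.
move=> fM; apply/bounded_linear_continuous/bounded_funP => r.
have [|] := boolP (0 <= M) => M0.
  by exists (M * r) => x xr; rewrite (le_trans (fM x))// ler_wpM2l.
exists 0 => x xr; rewrite (le_trans (fM x))//.
have [->|x0] := eqVneq x 0; first by rewrite normr0 mulr0.
have := fM x.
move=> /(le_trans (normr_ge0 _)); rewrite pmulr_lge0 ?normr_gt0//.
by rewrite (negbTE M0).
Qed.

Section Dual_of.
Variables (f : V -> R[i]^o) (lf : linear f) (M : R[i]).
Hypothesis fM : forall x, `|f x| <= M * `|x|.

Fact dual_of_subproof : f \in @dual_pred R V.
Proof.
rewrite inE; split => //.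
pose L := GRing.isLinear.Build R[i] V R[i]^o *:%R f lf.
pose g : {linear V -> R[i]^o} := HB.pack f L.
exact: (@bounded_continuous _ g M).
Qed.

Definition dual_of := Dual dual_of_subproof.

End Dual_of.

Let ReE F x : (complex.Re `|F x|)%:C = `|F x|.
Proof. by rewrite [RHS]normr_ReE. Qed.

(* Operator norm. Norms over R[i] take values in R[i]; the supremum needs R. *)
Definition dual_norm F : R :=
  sup [set complex.Re `|F x| | x in [set x | `|x| <= 1]].

Lemma dual_bounded F : exists M : R, forall x, `|F x| <= M%:C * `|x|.
Proof.
have /linear_boundedP : bounded_near F (nbhs (0 : V)).
  by apply/continuous_linear_bounded/dual_continuous.
move=> /pinfty_ex_gt0[M /gt0_complexE[r r0 ->] Fr]; by exists r.
Qed.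

Lemma dual_norm_has_sup F :
  has_sup [set complex.Re `|F x| | x in [set x | `|x| <= 1]].
Proof.
split; first by exists (complex.Re `|F 0|), 0 => //=; rewrite normr0 ler01.
have [M FM] := dual_bounded F.
exists `|M| => _ [x /= x1 <-]; rewrite -lecR ReE.
rewrite (le_trans (FM x))// (normr_ReE x) -rmorphM/= lecR.
rewrite (le_trans (ler_norm _))// normrM ler_piMr//.
by rewrite ger0_norm ?normr_Re_ge0// -lecR -normr_ReE.
Qed.

Lemma ler_dual_norm F x : `|F x| <= (dual_norm F)%:C * `|x|.
Proof.
have [->|x0] := eqVneq x 0; first by rewrite linear0 !normr0 mulr0.
have nx0 : `|x| != 0 by rewrite normr_eq0.
pose y := `|x|^-1 *: x.
have y1 : `|y| = 1 by rewrite normrZ normfV normr_id mulVf.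
have -> : F x = `|x| *: F y by rewrite linearZ/= scalerA divff// scale1r.
rewrite normrZ normr_id mulrC ler_wpM2r// -[leLHS]ReE lecR.
apply: sup_upper_bound; first exact: dual_norm_has_sup.
by exists y => //=; rewrite y1.
Qed.

Lemma dual_norm_le F (M : R) : 0 <= M ->
  (forall x, `|F x| <= M%:C * `|x|) -> dual_norm F <= M.
Proof.
move=> M0 FM; apply: ge_sup; first by case: (dual_norm_has_sup F).
move=> _ [x /= x1 <-]; rewrite -lecR ReE (le_trans (FM x))//.
by rewrite ler_piMr// lecR.
Qed.

Lemma dual_norm_ge0 F : 0 <= dual_norm F.
Proof.
apply: (@le_trans _ _ (complex.Re `|F 0|)); first exact: normr_Re_ge0.
apply: sup_upper_bound; first exact: dual_norm_has_sup.
by exists 0 => //=; rewrite normr0 ler01.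
Qed.

Fact dual_normD F G :
  (dual_norm (F + G))%:C <= (dual_norm F)%:C + (dual_norm G)%:C.
Proof.
rewrite -rmorphD/= lecR; apply: dual_norm_le.
  by rewrite addr_ge0// dual_norm_ge0.
move=> x; rewrite dualDE (le_trans (ler_normD _ _))// rmorphD/= mulrDl.
by rewrite lerD// ler_dual_norm.
Qed.

Fact dual_normZ (k : R[i]) F :
  (dual_norm (k *: F))%:C = `|k| * (dual_norm F)%:C.
Proof.
have le l G : (dual_norm (l *: G))%:C <= `|l| * (dual_norm G)%:C.
  have [r r0 lr] : exists2 r : R, 0 <= r & `|l| = r%:C.
    by exists (complex.Re `|l|); [exact: normr_Re_ge0|exact: normr_ReE].
  rewrite lr -rmorphM/= lecR; apply: dual_norm_le.
    by rewrite mulr_ge0// dual_norm_ge0.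
  move=> x; rewrite rmorphM/= -lr -mulrA.
  rewrite [leLHS](_ : _ = `|l| * `|G x|); last exact: normrM.
  by apply: ler_wpM2l => //; exact: ler_dual_norm.
have [->|k0] := eqVneq k 0.
  apply/eqP; rewrite eq_le le/= normr0 mul0r ler0c; exact: dual_norm_ge0.
apply/eqP; rewrite eq_le le/= -ler_pdivlMl ?normr_gt0// -normfV.
by rewrite (le_trans _ (le _ _))// scalerA mulVf// scale1r.
Qed.

Fact dual_norm0_eq0 F : (dual_norm F)%:C = 0 -> F = 0.
Proof.
move=> F0; apply: dualP => x.
by have := ler_dual_norm F x; rewrite F0 mul0r normr_le0 => /eqP.
Qed.

HB.instance Definition _ := @Lmodule_isNormed.Build R[i] (dual V)
  (fun F => (dual_norm F)%:C) dual_normD dual_normZ dual_norm0_eq0.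

Lemma dual_normE F : `|F| = (dual_norm F)%:C. Proof. by []. Qed.

Lemma ler_dual F x : `|F x| <= `|F| * `|x|.
Proof. exact: ler_dual_norm. Qed.

Lemma dual_le F (M : R[i]) : 0 <= M ->
  (forall x, `|F x| <= M * `|x|) -> `|F| <= M.
Proof.
move=> M0; rewrite dual_normE -(RRe_real (ger0_real M0)) lecR => FM.
by apply: dual_norm_le => //; rewrite -lecR RRe_real// ger0_real.
Qed.

Lemma dual_cauchy_cvg (F : set_system (dual V)) :
  ProperFilter F -> cauchy F -> cvg F.
Proof.
move=> FF /cauchyP Fc.
have evx x : cvg ((fun G : dual V => G x) @ F).
  apply: complex_cauchy_cvg; apply: cauchy_exP => e e0.
  have x1 : 0 < `|x| + 1 by rewrite ltr_wpDl.
  have [|G FG] := Fc (e / (`|x| + 1)); first by rewrite divr_gt0.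
  exists (G x); apply: (@filterS _ F _ _ _ _ FG) => H.
  rewrite -!ball_normE /ball_/= => GH.
  rewrite -[G x - H x]/((G - H) x) (le_lt_trans (ler_dual _ _))//.
  rewrite (@le_lt_trans _ _ (`|G - H| * (`|x| + 1)))//.
    by rewrite ler_wpM2l// lerDl.
  by rewrite -ltr_pdivlMr.
pose f x : R[i]^o := lim ((fun G : dual V => G x) @ F).
have fE x : (fun G : dual V => G x) @ F --> f x by exact: evx.
have lf : linear f.
  move=> k u v; apply: (cvg_lim (@norm_hausdorff _ R[i]^o)).
  rewrite (_ : (fun G : dual V => G (k *: u + v)) =
    (fun G : dual V => k *: (G u : R[i]^o) + G v)); last first.
    by apply/funext => G; rewrite linearP.
  by apply: cvgD => //; apply: cvgZr.
pose Lf := GRing.isLinear.Build R[i] V R[i]^o *:%R f lf.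
pose g : {linear V -> R[i]^o} := HB.pack f Lf.
have fB (e : R[i]) (G : dual V) : 0 < e -> F (ball G (e / 2)) ->
    forall x, `|f x - G x| <= e * `|x|.
  move=> e0 FG x; have [->|x0] := eqVneq x 0.
    by rewrite linear0 (linear0 g : f 0 = 0) subrr !normr0 mulr0.
  have ex0 : 0 < e / 2 * `|x| by rewrite mulr_gt0 ?normr_gt0// divr_gt0.
  have Nx : \forall H \near F, `|f x - (H : dual V) x| < e / 2 * `|x|.
    by move/cvgrPdist_lt : (fE x); exact.
  have [H [Hx GH]] := filter_ex (filterI Nx FG).
  rewrite -(subrKA (H x)) (le_trans (ler_normD _ _))// (splitr e) mulrDl.
  rewrite lerD ?(ltW Hx)//.
  rewrite -[H x - G x]/((H - G) x) (le_trans (ler_dual _ _))// distrC.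
  by move: GH; rewrite -ball_normE /ball_/= => GH; rewrite ler_wpM2r// ltW.
have [G1 FG1] := Fc (1 / 2) (divr_gt0 ltr01 (ltr0n _ 2)).
have fM x : `|f x| <= (1 + `|G1|) * `|x|.
  rewrite -[f x](subrK (G1 x)) (le_trans (ler_normD _ _))// mulrDl lerD//.
    exact: fB.
  exact: ler_dual.
apply/cvg_ex; exists (dual_of lf fM); apply/cvgrPdist_lt => e e0.
have e20 : 0 < e / 2 by rewrite divr_gt0.
have e40 : 0 < e / 2 / 2 by rewrite divr_gt0.
have [G FG] := Fc _ e40.
have fG : `|dual_of lf fM - G| <= e / 2.
  by apply: dual_le; [exact: ltW|exact: fB].
apply: (@filterS _ F _ _ _ _ FG) => H; rewrite -ball_normE /ball_/= => GH.
rewrite (splitr e) -(subrKA G) (le_lt_trans (ler_normD _ _))//.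
by rewrite ler_ltD// (lt_trans GH)// ltr_pdivrMr// ltr_pMr// ltr1n.
Qed.

HB.instance Definition _ :=
  Uniform_isComplete.Build (dual V) dual_cauchy_cvg.

End dual_norm.

Section algebra_theory.
Variables (K : numFieldType) (A : banachAlgType K).
Implicit Types a b : A.

Lemma bmulBr a b c : a ** (b - c) = a ** b - a ** c.
Proof. by rewrite bmulDr -[- c]scaleN1r -bscalerAr scaleN1r. Qed.

End algebra_theory.

(* The dual bimodule: <a.F, b> = <F, ba> and <F.a, b> = <F, ab>. *)
Section dual_bimodule.
Variables (R : realType) (A : banachAlgType R[i]).
Implicit Types (F : dual A) (a b : A).

Fact dual_lact_linear a F : linear (fun b => F (b ** a) : R[i]^o).
Proof. by move=> k u v; rewrite bmulDl -bscalerAl linearP. Qed.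

Fact dual_lact_le a F b : `|F (b ** a)| <= `|F| * `|a| * `|b|.
Proof.
rewrite (le_trans (ler_dual _ _))// -mulrA ler_wpM2l// mulrC.
exact: ler_normbM.
Qed.

Definition dual_lact a F : dual A :=
  dual_of (dual_lact_linear a F) (dual_lact_le a F).

Fact dual_ract_linear F a : linear (fun b => F (a ** b) : R[i]^o).
Proof. by move=> k u v; rewrite bmulDr -bscalerAr linearP. Qed.

Fact dual_ract_le F a b : `|F (a ** b)| <= `|F| * `|a| * `|b|.
Proof.
rewrite (le_trans (ler_dual _ _))// -mulrA ler_wpM2l//.
exact: ler_normbM.
Qed.

Definition dual_ract F a : dual A :=
  dual_of (dual_ract_linear F a) (dual_ract_le F a).

Lemma dual_lactE a F b : dual_lact a F b = F (b ** a). Proof. by []. Qed.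

Lemma dual_ractE F a b : dual_ract F a b = F (a ** b). Proof. by []. Qed.

Fact dual_lactDl a b F : dual_lact (a + b) F = dual_lact a F + dual_lact b F.
Proof. by apply: dualP => c; rewrite dualDE !dual_lactE bmulDr linearD. Qed.

Fact dual_lactDr a F G : dual_lact a (F + G) = dual_lact a F + dual_lact a G.
Proof. by apply: dualP => c. Qed.

Fact dual_lactZl (k : R[i]) a F : dual_lact (k *: a) F = k *: dual_lact a F.
Proof. by apply: dualP => c; rewrite dual_lactE -bscalerAr linearZ. Qed.

Fact dual_lactZr (k : R[i]) a F : dual_lact a (k *: F) = k *: dual_lact a F.
Proof. by apply: dualP => c. Qed.

Fact dual_ractDl F G a : dual_ract (F + G) a = dual_ract F a + dual_ract G a.
Proof. by apply: dualP => c. Qed.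

Fact dual_ractDr F a b : dual_ract F (a + b) = dual_ract F a + dual_ract F b.
Proof. by apply: dualP => c; rewrite dualDE !dual_ractE bmulDl linearD. Qed.

Fact dual_ractZl (k : R[i]) F a : dual_ract (k *: F) a = k *: dual_ract F a.
Proof. by apply: dualP => c. Qed.

Fact dual_ractZr (k : R[i]) F a : dual_ract F (k *: a) = k *: dual_ract F a.
Proof. by apply: dualP => c; rewrite dual_ractE -bscalerAl linearZ. Qed.

Fact dual_lactM a b F : dual_lact (a ** b) F = dual_lact a (dual_lact b F).
Proof. by apply: dualP => c; rewrite !dual_lactE bmulA. Qed.

Fact dual_ractM F a b : dual_ract F (a ** b) = dual_ract (dual_ract F a) b.
Proof. by apply: dualP => c; rewrite !dual_ractE bmulA. Qed.

Fact dual_lractA a F b :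
  dual_ract (dual_lact a F) b = dual_lact a (dual_ract F b).
Proof.
by apply: dualP => c; rewrite dual_ractE !dual_lactE dual_ractE bmulA.
Qed.

Fact dual_lact_bounded :
  exists M : R[i], forall a F, `|dual_lact a F| <= M * `|a| * `|F|.
Proof.
exists 1 => a F; rewrite mul1r mulrC.
by apply: dual_le => [|b]; [rewrite mulr_ge0|exact: dual_lact_le].
Qed.

Fact dual_ract_bounded :
  exists M : R[i], forall F a, `|dual_ract F a| <= M * `|F| * `|a|.
Proof.
exists 1 => F a; rewrite mul1r.
by apply: dual_le => [|b]; [rewrite mulr_ge0|exact: dual_ract_le].
Qed.

HB.instance Definition _ :=
  CompleteNormedModule_isBanachBimodule.Build R[i] A (dual A)
    dual_lactDl dual_lactDr dual_lactZl dual_lactZr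
    dual_ractDl dual_ractDr dual_ractZl dual_ractZr
    dual_lactM dual_ractM dual_lractA dual_lact_bounded dual_ract_bounded.

End dual_bimodule.

(* Continuity is not part of the definition: see ler_char below. *)
Record character (R : realType) (A : banachAlgType R[i]) := Character {
  char_fun :> {linear A -> R[i]^o};
  charM : forall a b, char_fun (a ** b) = char_fun a * char_fun b;
  char_neq0 : exists a, char_fun a != 0
}.

Section character_theory.
Variables (R : realType) (A : banachAlgType R[i]) (phi : character A).

Lemma quasi_inverse (a : A) : `|a| < 1 -> exists b, b = a + a ** b.
Proof.
move=> a1; have [r r0 ar] : exists2 r : R, 0 <= r & `|a| = r%:C.
  by exists (complex.Re `|a|); [exact: normr_Re_ge0|exact: normr_ReE].
have r1 : r < 1 by rewrite -ltcR -ar.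
pose C := r / (1 - r).
have C0 : 0 <= C by rewrite divr_ge0// subr_ge0 ltW.
have CE : C = r + C * r.
  have /eqP : C * (1 - r) = r by rewrite divfK// subr_eq0 gt_eqF.
  by rewrite mulrBr mulr1 subr_eq => /eqP.
pose y n := iter n (fun b => a + a ** b) 0.
have yS n : y n.+1 = a + a ** y n by [].
have yC k : `|y k| <= C%:C.
  elim: k => [|k IH]; first by rewrite normr0 lecR.
  rewrite (le_trans (ler_normD _ _))// (@le_trans _ _ ((r + r * C)%:C))//.
    rewrite rmorphD/= -ar lerD// (le_trans (ler_normbM _ _))// ar rmorphM/=.
    by rewrite ler_wpM2l// lecR.
  by rewrite lecR [r * C]mulrC -CE.
have yB n k : `|y n - y (n + k)%N| <= (r ^+ n * C)%:C.
  elim: n => [|n IH]; first by rewrite sub0r normrN expr0 mul1r.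
  rewrite addSn !yS opprD addrACA subrr add0r -bmulBr.
  rewrite (le_trans (ler_normbM _ _))// exprS -mulrA rmorphM/= ar.
  by rewrite ler_wpM2l// lecR.
have /cvg_ex[l yl] : cvg (y @ \oo).
  apply: cauchy_cvg; apply: cauchy_exP => _ /gt0_complexE[e e0 ->].
  have /cvgrPdist_lt/(_ e e0)[N _ HN] :
      (fun n => C * r ^+ n) @ \oo --> (0 : R).
    by apply: cvg_geometric; rewrite ger0_norm.
  exists (y N); exists N => // n /= Nn.
  rewrite -ball_normE/= /ball_/= -(subnKC Nn) (le_lt_trans (yB _ _))// ltcR.
  have := HN N (leqnn N).
  by rewrite /= sub0r normrN ger0_norm 1?mulrC// mulr_ge0// exprn_ge0.
have yl1 : [sequence y n.+1]_n @ \oo --> l by rewrite cvg_shiftS.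
exists l; apply: (norm_cvg_unique yl1).
apply/cvgrPdist_lt => e e0; move/cvgrPdist_lt : yl => /(_ e e0).
apply: filterS => n ln; change (`|(a + a ** l) - (a + a ** y n)| < e).
rewrite opprD addrACA subrr add0r -bmulBr.
rewrite (le_lt_trans (ler_normbM _ _))// (le_lt_trans _ ln)//.
by rewrite ler_piMl// ltW.
Qed.

Lemma ler_char (a : A) : `|phi a| <= 1 * `|a|.
Proof.
rewrite mul1r real_leNgt ?normr_real//; apply/negP => a_lt.
have pa0 : phi a != 0.
  by rewrite -normr_gt0; exact: le_lt_trans a_lt.
have [|b bE] := @quasi_inverse ((phi a)^-1 *: a).
  rewrite normrZ normfV mulrC ltr_pdivrMr ?mul1r//.
  by rewrite normr_gt0.
have := congr1 phi bE; rewrite linearD charM linearZ/=.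
rewrite -[_ *: phi a]/((phi a)^-1 * phi a) mulVf// mul1r => /eqP.
by rewrite -subr_eq subrr eq_sym oner_eq0.
Qed.

Definition char_dual : dual A := dual_of (linearP phi) ler_char.

Definition char_ker : set A := [set a | phi a = 0].

Definition char_ker2 : set A :=
  lin_span [set x ** y | x in char_ker & y in char_ker].

Definition point_derivation (d : dual A) :=
  forall a b, d (a ** b) = d a * phi b + phi a * d b.

End character_theory.

Coercion char_dual : character >-> dual.

(* The bimodule with carrier C and actions a.z = z.a = phi(a) z. *)
Definition Cphi (R : realType) (A : banachAlgType R[i]) (phi : character A) :
  Type := R[i]^o.

Section Cphi_bimodule.
Variables (R : realType) (A : banachAlgType R[i]) (phi : character A).
Local Notation Cphi := (Cphi phi).

HB.instance Definition _ := NormedModule.copy Cphi R[i]^o.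

HB.instance Definition _ :=
  Uniform_isComplete.Build Cphi (@complex_cauchy_cvg R).

Definition Cphi_lact (a : A) (z : Cphi) : Cphi := (phi a : R[i]) *: z.
Definition Cphi_ract (z : Cphi) (a : A) : Cphi := (phi a : R[i]) *: z.

Fact Cphi_actDl a b z : Cphi_lact (a + b) z = Cphi_lact a z + Cphi_lact b z.
Proof. by rewrite /Cphi_lact linearD scalerDl. Qed.

Fact Cphi_actDr a z w : Cphi_lact a (z + w) = Cphi_lact a z + Cphi_lact a w.
Proof. by rewrite /Cphi_lact scalerDr. Qed.

Fact Cphi_actZl (k : R[i]) a z : Cphi_lact (k *: a) z = k *: Cphi_lact a z.
Proof. by rewrite /Cphi_lact linearZ scalerA. Qed.

Fact Cphi_actZr (k : R[i]) a z : Cphi_lact a (k *: z) = k *: Cphi_lact a z.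
Proof. by rewrite /Cphi_lact !scalerA mulrC. Qed.

Fact Cphi_lactM a b z : Cphi_lact (a ** b) z = Cphi_lact a (Cphi_lact b z).
Proof. by rewrite /Cphi_lact charM scalerA. Qed.

Fact Cphi_ractM z a b : Cphi_ract z (a ** b) = Cphi_ract (Cphi_ract z a) b.
Proof. by rewrite /Cphi_ract charM scalerA mulrC. Qed.

Fact Cphi_lractA a z b :
  Cphi_ract (Cphi_lact a z) b = Cphi_lact a (Cphi_ract z b).
Proof. by rewrite /Cphi_lact /Cphi_ract !scalerA mulrC. Qed.

Fact Cphi_lact_bounded :
  exists M : R[i], forall a z, `|Cphi_lact a z| <= M * `|a| * `|z|.
Proof.
exists 1 => a z; rewrite /Cphi_lact normrZ ler_wpM2r//; exact: ler_char.
Qed.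

Fact Cphi_ract_bounded :
  exists M : R[i], forall z a, `|Cphi_ract z a| <= M * `|z| * `|a|.
Proof.
exists 1 => z a; rewrite /Cphi_ract normrZ mul1r mulrC ler_wpM2l//.
by rewrite -[leRHS]mul1r; exact: ler_char.
Qed.

HB.instance Definition _ :=
  CompleteNormedModule_isBanachBimodule.Build R[i] A Cphi
    Cphi_actDl Cphi_actDr Cphi_actZl Cphi_actZr
    (fun z w a => Cphi_actDr a z w) (fun z a b => Cphi_actDl a b z)
    (fun k z a => Cphi_actZr k a z) (fun k z a => Cphi_actZl k a z)
    Cphi_lactM Cphi_ractM Cphi_lractA Cphi_lact_bounded Cphi_ract_bounded.

End Cphi_bimodule.

(* <frakD F1 F2 a, b> = F1(a) F2(b). *)
Definition frakD (R : realType) (A : banachAlgType R[i]) (F1 F2 : dual A) :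
  A -> dual A := fun a => (F1 a : R[i]) *: F2.

(* Main.v *)
Require Import Defs.
From HB Require Import structures.
From mathcomp Require Import all_boot all_order all_algebra.
From mathcomp Require Import complex.
From mathcomp Require Import boolp classical_sets functions reals.
From mathcomp Require Import topology normedtype.

Import Order.TTheory GRing.Theory Num.Theory.
Import numFieldNormedType.Exports.

Local Open Scope classical_set_scope.
Local Open Scope ring_scope.
Local Open Scope complex_scope.

(** A functional takes values in a commutative ring, so the point derivation
    identity is exactly the derivation identity for the bimodule C_phi, where
    both actions are multiplication by phi; linearity and continuity come with
    membership in the dual.  For the operator frakD d phi, multiplicativity of
    phi turns the two sides of the derivation identity at (a, b), evaluated at
    c, into d(ab) phi(c) and (d(a) phi(b) + phi(a) d(b)) phi(c): these agree
    for all c as soon as d is a point derivation, and conversely the factor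
    phi(c) can be cancelled by picking c with phi(c) <> 0.  Finally, a point
    derivation kills a product of two elements of the kernel of phi, since
    each term of the Leibniz rule carries a factor phi(x) or phi(y), and hence
    it kills the linear span of these products. *)

Section point_derivations.
Variables (R : realType) (A : banachAlgType R[i]).
Implicit Types (F G d : dual A) (phi : character A) (a b c : A).

Lemma frakDE F G a b : frakD F G a b = F a * G b.
Proof. by []. Qed.

Lemma frakD_linear F G : linear (frakD F G).
Proof.
by move=> k a b; rewrite /frakD linearP scalerDl scalerA.
Qed.

Lemma frakD_continuous F G : continuous (frakD F G).
Proof.
pose L := GRing.isLinear.Build R[i] A (dual A) *:%R _ (frakD_linear F G).
pose D : {linear A -> dual A} := HB.pack (frakD F G) L.
apply: (@bounded_continuous _ _ _ D (`|F| * `|G|)) => a.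
by rewrite normrZ mulrAC ler_wpM2r// ler_dual.
Qed.

(** Left and right actions on a multiple of phi only rescale it by phi(a),
    because phi (c ** a) = phi (a ** c) = phi a * phi c. *)
Lemma frakD_char_Leibniz phi d a b c :
  (ract (frakD d phi a) b + lact a (frakD d phi b)) c =
  (d a * phi b + phi a * d b) * phi c.
Proof.
rewrite dualDE.
rewrite -[X in X + _]/(d a * phi (b ** c)) -[X in _ + X]/(d b * phi (c ** a)).
by rewrite !charM mulrDl mulrA [phi c * _]mulrC mulrA [d b * _]mulrC.
Qed.

(** The identity for frakD d phi is the one for d tensored with phi, so a single
    c with phi c <> 0 already recovers the latter. *)
Lemma is_derivation_frakD phi d :
  is_derivation (frakD d phi) <-> point_derivation phi d.
Proof.
split=> [[_ Dd] a b|pd].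
  have [c phic0] := char_neq0 phi.
  by apply: (mulIf phic0); rewrite -frakD_char_Leibniz -Dd.
split=> [|a b]; first exact: frakD_linear.
by apply: dualP => c; rewrite frakD_char_Leibniz frakDE pd.
Qed.

Lemma is_derivation_Cphi phi d :
  is_derivation (d : A -> Cphi phi) <-> point_derivation phi d.
Proof.
(* the right action is scaling by phi(b), written on the left of d(a) *)
have LE a b : ract (d a : Cphi phi) b + lact a (d b : Cphi phi) =
    d a * phi b + phi a * d b by rewrite [d a * _]mulrC.
split=> [[_ Dd] a b|pd]; first by rewrite -LE -Dd.
by split=> [|a b]; [exact: dual_linear|rewrite LE pd].
Qed.

Lemma point_derivation_char_ker2 phi d :
  point_derivation phi d -> forall x, char_ker2 phi x -> d x = 0.
Proof.
move=> pd _ [n [k [s [sM ->]]]]; rewrite linear_sum big1// => i _.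
have [x phix0 [y phiy0 <-]] := sM i.
by rewrite linearZ/= pd phix0 phiy0 mulr0 mul0r addr0 scaler0.
Qed.

End point_derivations.

Theorem proposition2p4 (R : realType) (A : banachAlgType R[i])
    (phi : character A) (d : dual A) :
  [/\ point_derivation phi d <->
        (is_derivation (d : A -> Cphi phi) /\
         continuous (d : A -> Cphi phi)),
      point_derivation phi d <->
        (is_derivation (frakD d phi) /\ continuous (frakD d phi)) &
      point_derivation phi d -> forall x, char_ker2 phi x -> d x = 0].
Proof.
split; last exact: point_derivation_char_ker2.
- split=> [pd|[/is_derivation_Cphi//]].
  by split; [exact/is_derivation_Cphi|exact: dual_continuous].
- split=> [pd|[/is_derivation_frakD//]].
  by split; [exact/is_derivation_frakD|exact: frakD_continuous].
Qed.
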